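(* Let $q,n\ge1$ and let $f_n(z)=A_0z^n+A_1z^{n-1}+\cdots+A_n$ with $A_k\in\mathbb{C}^{q\times q}$ and $\det A_0\neq0$. If $f_n$ is a Hurwitz-type matrix polynomial (HTM polynomial), then $f_n$ is a Hurwitz matrix polynomial, i.e. every $z\in\mathbb{C}$ with $\det f_n(z)=0$ satisfies $\operatorname{Re}z<0$.
   Context: Parts. For $f_n(z)=\sum_{k=0}^nA_kz^{n-k}$, the matrix polynomials $h_n,g_n$ are determined by $f_n(z)=h_n(z^2)+z\,g_n(z^2)$. Thus, for $n=2m$, $h_n(z)=A_0z^m+A_2z^{m-1}+\cdots+A_{2m}$ and $g_n(z)=A_1z^{m-1}+A_3z^{m-2}+\cdots+A_{2m-1}$; for $n=2m+1$, $h_n(z)=A_1z^m+A_3z^{m-1}+\cdots+A_{2m+1}$ and $g_n(z)=A_0z^m+A_2z^{m-1}+\cdots+A_{2m}$. HTM polynomial. For $n=2m$ ($m\ge1$), $f_n$ is an HTM polynomial if there are (Hermitian) positive definite $q\times q$ matrices $c_0,\dots,c_{m-1},d_0,\dots,d_{m-1}$ such that $g_n(z)h_n(z)^{-1}=\Psi_0(z)$ as rational matrix functions, where $\Psi_{m-1}(z)=(zc_{m-1}+d_{m-1}^{-1})^{-1}$ and $\Psi_k(z)=\big(zc_k+(d_k+\Psi_{k+1}(z))^{-1}\big)^{-1}$ for $0\le k\le m-2$. For $n=2m+1$ ($m\ge0$), $f_n$ is an HTM polynomial if there are positive definite $c_0,\dots,c_m,d_0,\dots,d_{m-1}$ such that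 $h_n(z)(z g_n(z))^{-1}=\Phi_0(z)$ as rational matrix functions, where $\Phi_m(z)=z^{-1}c_m^{-1}$ and $\Phi_k(z)=\big(zc_k+(d_k+\Phi_{k+1}(z))^{-1}\big)^{-1}$ for $0\le k\le m-1$. *)

(* Defs.v *)
From HB Require Import structures.
From mathcomp Require Import all_boot all_order all_algebra.
From mathcomp Require Import reals.
From mathcomp Require Import complex.

Set Implicit Arguments.
Unset Strict Implicit.
Unset Printing Implicit Defensive.

Import Order.TTheory GRing.Theory Num.Theory.

Local Open Scope ring_scope.
Local Open Scope complex_scope.
Local Open Scope sesquilinear_scope.

(* A q x q matrix polynomial over C is represented as a matrix of polynomials,
   and a rational matrix function as a matrix over the field C(z). *)
Notation ratfun C := {fraction {poly C}}.

(* The strict order on R[i] is the partial one: 0 < w means that w is real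
   and positive. *)
Definition posdefmx (R : realType) (q : nat) (M : 'M[R[i]]_q) : Prop :=
  M \is hermsymmx /\
  forall v : 'cV[R[i]]_q, v != 0 -> 0 < (v ^t* *m M *m v) ord0 ord0.

Section MatrixPolynomials.
Variables (C : comNzRingType) (q : nat).
Implicit Types f : 'M[{poly C}]_q.

Definition matpoly (n : nat) (A : 'I_n.+1 -> 'M[C]_q) : 'M[{poly C}]_q :=
  \sum_(k < n.+1) 'X^(n - k) *: map_mx polyC (A k).

Definition evalmx f (z : C) : 'M[C]_q := map_mx (fun p => p.[z]) f.

(* The matrix polynomials h and g such that f(z) = h(z^2) + z g(z^2), see
   [parts_decomposition] below. *)
Definition hpart f : 'M[{poly C}]_q := map_mx (@even_poly C) f.
Definition gpart f : 'M[{poly C}]_q := map_mx (@odd_poly C) f.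

Lemma parts_decomposition f :
  f = map_mx (fun p => p \Po 'X^2) (hpart f)
      + 'X *: map_mx (fun p => p \Po 'X^2) (gpart f).
Proof.
by apply/matrixP => i j; rewrite !mxE mulrC poly_even_odd.
Qed.

End MatrixPolynomials.

Section HTM.
Variables (R : realType) (q : nat).
Local Notation C := R[i].
Local Notation RatMx := 'M[ratfun C]_q.
Implicit Types (f : 'M[{poly C}]_q) (M : 'M[C]_q) (c d : nat -> 'M[C]_q).

Definition ratmx f : RatMx := map_mx (@tofrac {poly C}) f.
Definition constmx M : RatMx := ratmx (map_mx polyC M).
Definition zvar : ratfun C := tofrac 'X.

(* [invmx] is total and returns its argument when that is singular. This is
   harmless below: for positive definite parameters every matrix inverted in
   the chains has nonzero determinant in C(z), and so do h_n (n even) and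
   z g_n (n odd), whose leading coefficient is A_0, when det A_0 != 0. *)
Definition chain_step M (N : 'M[C]_q) (X : RatMx) : RatMx :=
  invmx (zvar *: constmx M + invmx (constmx N + X)).

(* [Psi c d r k] is Psi_k for the chain whose last index is m - 1 = k + r, and
   [Phi c d r k] is Phi_k for the chain whose last index is m = k + r. *)
Fixpoint Psi c d (r k : nat) : RatMx :=
  if r is r'.+1 then chain_step (c k) (d k) (Psi c d r' k.+1)
  else invmx (zvar *: constmx (c k) + invmx (constmx (d k))).

Fixpoint Phi c d (r k : nat) : RatMx :=
  if r is r'.+1 then chain_step (c k) (d k) (Phi c d r' k.+1)
  else zvar^-1 *: invmx (constmx (c k)).

Definition HTM_even (m : nat) f : Prop :=
  (0 < m)%N /\
  exists c d : nat -> 'M[C]_q,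
    [/\ forall k, (k < m)%N -> posdefmx (c k),
        forall k, (k < m)%N -> posdefmx (d k)
      & ratmx (gpart f) *m invmx (ratmx (hpart f)) = Psi c d m.-1 0].

Definition HTM_odd (m : nat) f : Prop :=
  exists c d : nat -> 'M[C]_q,
    [/\ forall k, (k <= m)%N -> posdefmx (c k),
        forall k, (k < m)%N -> posdefmx (d k)
      & ratmx (hpart f) *m invmx (zvar *: ratmx (gpart f)) = Phi c d m 0].

(* [n] is the formal degree of [f], and n = 2m or n = 2m + 1 with m = n./2. *)
Definition HTM_polynomial (n : nat) f : Prop :=
  if odd n then HTM_odd n./2 f else HTM_even n./2 f.

Definition Hurwitz_polynomial f : Prop :=
  forall z : C, \det (evalmx f z) = 0 -> complex.Re z < 0.

End HTM.

(* Main.v *)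
Require Import Defs.
From mathcomp Require Import all_boot all_order all_algebra.
From mathcomp Require Import perm.
From mathcomp Require Import reals.
From mathcomp Require Import complex.

(** Write [b_0, ..., b_(n-1)] for the parameters of the chain listed in the
order [c_0, d_0, c_1, d_1, ...].  Unfolding the chain replaces a division by a
three-term recursion: there are matrix polynomials [X_0, ..., X_(n+1)] with
[X_j = z b_j X_(j+1) + X_(j+2)], [X_n = I], [X_(n+1) = 0], and
[f(z) = (X_0(z) + X_1(z)) V(z)] for some matrix polynomial [V].  Working in [z]
rather than in [z^2] puts the [c_k] and the [d_k], and the even and odd degrees
[n], on the same footing.

The factor [X_0 + X_1] is stable.  If [Re z >= 0], then for every vector [v]
the quantity [Re (X_(j+1) v)^* (X_j v)] is nonnegative, by downward induction
on [j]: each step adds [Re z] times a value of the form [b_j]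
([continuants_accretive]).  If moreover [(X_0 + X_1) v = 0], then
[X_1 v = - X_0 v] and the quantity for [j = 0] is [- |X_0 v|^2].  Hence
[X_0 v = X_1 v = 0], and the recursion, read upwards in [j], gives [v = 0]
([det_continuants_neq0]).

The factor [V] contributes no zeros.  Both [det f] and [det (X_0 + X_1)] have
degree exactly [q n], since the leading coefficients [A_0] and
[b_0 ... b_(n-1)] are invertible, so [det V] is a nonzero constant
([Hurwitz_continuants]).

The factorization comes from a Euclidean descent on polynomial matrices.  If
[P = Psi_k Q], then [Q' = Q - z c_k P] and [P' = P - d_k Q'] are again
polynomial and satisfy [P' = Psi_(k+1) Q'] ([chain_step_descent]).  This
cancels matrices of rational functions, whose invertibility has to be known:
each of them takes at [z = 1] a value with a positive definite form, a property
that inversion and the addition of [z c_k] or [d_k] preserve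
([positive_at1]). *)

Set Implicit Arguments.
Unset Strict Implicit.
Unset Printing Implicit Defensive.

Import Order.TTheory GRing.Theory Num.Theory.
Local Open Scope ring_scope.
Local Open Scope sesquilinear_scope.

(** * Leading coefficients of determinants *)

Lemma coef_mul_top (C : comNzRingType) (p r : {poly C}) (a b : nat) :
  (size p <= a.+1)%N -> (size r <= b.+1)%N ->
  (size (p * r)%R <= (a + b).+1)%N /\ (p * r)`_(a + b) = p`_a * r`_b.
Proof.
move=> sp sr; split.
  apply: leq_trans (size_polyMleq _ _) _.
  have := leq_add sp sr; rewrite addSn addnS.
  by case: (size p + size r)%N => //= k; rewrite ltnS.
have ha : (a < (a + b).+1)%N by rewrite ltnS leq_addr.
rewrite coefM (bigD1 (Ordinal ha)) //= addKn big1 ?addr0 // => i ni.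
have [lt_ia | lt_ai | eq_ia] := ltngtP i a.
- rewrite [r`__]nth_default ?mulr0 //; apply: leq_trans sr _.
  by rewrite -addnBAC ?(ltnW lt_ia) // -[b.+1]add1n leq_add2r subn_gt0.
- by rewrite nth_default ?mul0r //; apply: leq_trans sp _.
- by case/eqP: ni; apply: val_inj.
Qed.

Lemma coef_prod_top (C : comNzRingType) (I : Type) (s : seq I)
    (F : I -> {poly C}) (n : nat) :
  (forall i, (size (F i) <= n.+1)%N) ->
  (size (\prod_(i <- s) F i)%R <= (size s * n).+1)%N /\
  (\prod_(i <- s) F i)`_(size s * n) = \prod_(i <- s) (F i)`_n.
Proof.
move=> sF; elim: s => [|i s [IHs IHc]].
  by rewrite !big_nil size_poly1 coef1.
rewrite !big_cons /= mulSn -IHc; exact: coef_mul_top.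
Qed.

(** Each of the [q] factors in a term of the Leibniz formula has formal degree
[n], so the coefficient of degree [q * n] only sees leading coefficients. *)
Lemma coef_det_top (C : comNzRingType) (q n : nat) (M : 'M[{poly C}]_q) :
  (forall i j, (size (M i j) <= n.+1)%N) ->
  (size (\det M) <= (q * n).+1)%N /\
  (\det M)`_(q * n) = \det (map_mx (fun p : {poly C} => p`_n) M).
Proof.
move=> sM.
have top (s : {perm 'I_q}) := coef_prod_top (index_enum 'I_q)
  (fun i => sM i (s i)).
have szI : size (index_enum 'I_q) = q.
  by rewrite [index_enum _]unlock -enumT size_enum_ord.
rewrite szI in top; rewrite /determinant; split.
  apply: leq_trans (size_sum _ _ _) _; apply/bigmax_leqP => s _.
  by rewrite size_Msign; case: (top s).
rewrite coef_sum; apply: eq_bigr => s _.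
have -> : (-1) ^+ s = ((-1) ^+ s : C)%:P by rewrite rmorph_sign.
rewrite coefCM (proj2 (top s)); congr (_ * _).
by apply: eq_bigr => i _; rewrite mxE.
Qed.

Lemma size_det_top (C : comNzRingType) (q n : nat) (M : 'M[{poly C}]_q) :
  (forall i j, (size (M i j) <= n.+1)%N) ->
  \det (map_mx (fun p : {poly C} => p`_n) M) != 0 ->
  size (\det M) = (q * n).+1.
Proof.
move=> /coef_det_top [sM <-] nz; apply/eqP; rewrite eqn_leq sM /=.
by rewrite ltnNge; apply: contra nz => ?; rewrite nth_default.
Qed.

(** * The Hermitian inner product on columns *)

Section Dot.
Variables (C : numClosedFieldType) (q : nat).
Implicit Types u v w : 'cV[C]_q.

Definition dot u v : C := (u ^t* *m v) ord0 ord0.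

Lemma dotE u v : dot u v = \sum_i (u i ord0)^* * v i ord0.
Proof. by rewrite /dot mxE; apply: eq_bigr => i _; rewrite !mxE. Qed.

Lemma dotDr u v w : dot u (v + w) = dot u v + dot u w.
Proof. by rewrite /dot mulmxDr mxE. Qed.

Lemma dotZr u v (a : C) : dot u (a *: v) = a * dot u v.
Proof. by rewrite /dot -scalemxAr mxE. Qed.

Lemma dotC u v : dot v u = (dot u v)^*.
Proof.
by rewrite !dotE rmorph_sum; apply: eq_bigr => i _;
  rewrite rmorphM /= conjCK mulrC.
Qed.

Lemma dot_ge0 v : 0 <= dot v v.
Proof.
by rewrite dotE sumr_ge0 // => i _; rewrite mulrC mul_conjC_ge0.
Qed.

Lemma dot_eq0 v : dot v v = 0 -> v = 0.
Proof.
rewrite dotE => /eqP; rewrite psumr_eq0 => [/allP /= v0|i _]; last first.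
  by rewrite mulrC mul_conjC_ge0.
apply/matrixP => i j; rewrite ord1 mxE; apply/eqP.
by rewrite -mul_conjC_eq0 mulrC; apply: v0; rewrite mem_index_enum.
Qed.

Lemma Re_dotC u v : 'Re (dot v u) = 'Re (dot u v).
Proof. by rewrite dotC Re_conj. Qed.

End Dot.

Local Open Scope complex_scope.

(** A column version of [det0P], the vectors here being columns. *)
Lemma det_colP (F : fieldType) (q : nat) (M : 'M[F]_q) :
  reflect (exists2 v : 'cV_q, v != 0 & M *m v = 0) (\det M == 0).
Proof.
rewrite -det_tr; apply: (iffP det0P) => -[v nzv vM]; exists v^T.
- by rewrite trmx_eq0.
- by rewrite -[M]trmxK -trmx_mul vM trmx0.
- by rewrite trmx_eq0.
- by rewrite -trmx_mul vM trmx0.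
Qed.

Lemma posdef_dot (R : realType) (q : nat) (M : 'M[R[i]]_q) (v : 'cV_q) :
  posdefmx M -> v != 0 -> 0 < dot v (M *m v).
Proof. by case=> _ posM nzv; rewrite /dot mulmxA; apply: posM. Qed.

Lemma posdef_dot_ge0 (R : realType) (q : nat) (M : 'M[R[i]]_q) (v : 'cV_q) :
  posdefmx M -> 0 <= dot v (M *m v).
Proof.
move=> pM; have [->|nzv] := eqVneq v 0; last exact/ltW/posdef_dot.
by rewrite mulmx0 dot_ge0.
Qed.

Lemma posdef_det (R : realType) (q : nat) (M : 'M[R[i]]_q) :
  posdefmx M -> \det M != 0.
Proof.
move=> pM; apply/negP => /det_colP [v nzv Mv].
by have := posdef_dot pM nzv; rewrite Mv /dot mulmx0 mxE ltxx.
Qed.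

(** * Continuants *)

Section Continuants.
Variables (C : comNzRingType) (q : nat).
Implicit Types (bs : seq 'M[C]_q) (M N : 'M[{poly C}]_q).

(** The pair [(X_0, X_1)] of the recursion [X_j = z b_j X_(j+1) + X_(j+2)] that
ends with [X_n = I], [X_(n+1) = 0]: the numerators and denominators of the
continued fraction with partial quotients [z b_j].  Dropping the head of the
list moves to the pair [(X_1, X_2)]. *)
Fixpoint continuants bs : 'M[{poly C}]_q * 'M[{poly C}]_q :=
  if bs is b :: bs' then
    ('X *: (map_mx polyC b *m (continuants bs').1) + (continuants bs').2,
     (continuants bs').1)
  else (1%:M, 0).

Lemma continuants_cons b bs : (continuants (b :: bs)).1 =
  'X *: (map_mx polyC b *m (continuants bs).1) + (continuants bs).2.
Proof. by []. Qed.

Lemma evalmxD M N z : evalmx (M + N) z = evalmx M z + evalmx N z.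
Proof. by apply/matrixP => i j; rewrite !mxE hornerD. Qed.

Lemma evalmxM M N z : evalmx (M *m N) z = evalmx M z *m evalmx N z.
Proof. exact: (map_mxM (horner_eval z)). Qed.

Lemma evalmxZ (p : {poly C}) M z : evalmx (p *: M) z = p.[z] *: evalmx M z.
Proof. by apply/matrixP => i j; rewrite !mxE hornerM. Qed.

Lemma evalmxC (B : 'M[C]_q) z : evalmx (map_mx polyC B) z = B.
Proof. by apply/matrixP => i j; rewrite !mxE hornerC. Qed.

Lemma evalmx1 z : evalmx (1%:M : 'M[{poly C}]_q) z = 1%:M.
Proof. exact: (map_mx1 (horner_eval z)). Qed.

Lemma evalmx0 z : evalmx (0 : 'M[{poly C}]_q) z = 0.
Proof. exact: (map_mx0 (horner_eval z)). Qed.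

Lemma det_evalmx M z : \det (evalmx M z) = (\det M).[z].
Proof. exact: (det_map_mx (horner_eval z)). Qed.

Lemma size_continuants bs :
  (forall i j, (size ((continuants bs).1 i j) <= (size bs).+1)%N) /\
  (forall i j, (size ((continuants bs).2 i j) <= size bs)%N).
Proof.
elim: bs => [|b bs [IHx IHy]] /=.
  split=> i j; rewrite !mxE ?size_poly0 //.
  by case: (i == j); rewrite ?size_poly1 ?size_poly0.
split=> // i j; rewrite !mxE.
apply: leq_trans (size_polyD _ _) _; rewrite geq_max; apply/andP; split.
  apply: leq_trans (size_polyMleq _ _) _; rewrite size_polyX /=.
  rewrite ltnS; apply: leq_trans (size_sum _ _ _) _; apply/bigmax_leqP => l _.
  rewrite mxE mul_polyC; exact: leq_trans (size_scale_leq _ _) (IHx _ _).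
by apply: leq_trans (IHy _ _) _; rewrite -addn2 leq_addr.
Qed.

Lemma coef_continuants b bs :
  map_mx (fun p : {poly C} => p`_(size bs).+1) (continuants (b :: bs)).1 =
  b *m map_mx (fun p : {poly C} => p`_(size bs)) (continuants bs).1.
Proof.
apply/matrixP => i j; rewrite !mxE coefD coefXM /= coef_sum.
rewrite [X in _ + X]nth_default ?addr0; last first.
  exact: leq_trans ((size_continuants bs).2 _ _) _.
by apply: eq_bigr => l _; rewrite !mxE coefCM.
Qed.

End Continuants.

Section Stability.
Variables (R : realType) (q : nat).
Local Notation C := R[i].
Implicit Types (bs : seq 'M[C]_q) (f V : 'M[{poly C}]_q) (v : 'cV[C]_q) (z : C).

Lemma det_coef_continuants bs : (forall b, b \in bs -> posdefmx b) ->
  \det (map_mx (fun p : {poly C} => p`_(size bs)) (continuants bs).1) != 0.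
Proof.
elim: bs => [_|b bs IH pbs] /=.
  rewrite (_ : map_mx _ _ = 1%:M) ?det1 ?oner_eq0 //.
  by apply/matrixP => i j; rewrite !mxE; case: eqP; rewrite ?coef1 ?coef0.
rewrite coef_continuants det_mulmx mulf_neq0 //.
  by apply: posdef_det; apply: pbs; rewrite mem_head.
by apply: IH => b' b'_bs; apply: pbs; rewrite inE b'_bs orbT.
Qed.

(** The energy estimate behind stability: when the recursion is substituted for
[X_j], the pairing of [X_(j+1) v] with [X_j v] becomes [z] times the form of
[b_j] at [X_(j+1) v], plus the pairing of the next two terms in reverse order,
which has the same real part. *)
Lemma continuants_accretive bs z v : (forall b, b \in bs -> posdefmx b) ->
  0 <= 'Re z ->
  0 <= 'Re (dot (evalmx (continuants bs).2 z *m v)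
                (evalmx (continuants bs).1 z *m v)).
Proof.
move=> pbs z_ge0; elim: bs pbs => [_|b bs IH pbs] /=.
  by rewrite evalmx0 mul0mx dotC /dot mulmx0 mxE rmorph0 raddf0.
set x := (continuants bs).1 in IH *; set y := (continuants bs).2 in IH *.
rewrite evalmxD evalmxZ hornerX evalmxM evalmxC mulmxDl -scalemxAl -mulmxA.
rewrite dotDr dotZr raddfD /= addr_ge0 //; last first.
  by rewrite Re_dotC; apply: IH => b' b'_bs; apply: pbs; rewrite inE b'_bs orbT.
have b_ge0 := posdef_dot_ge0 (evalmx x z *m v) (pbs b (mem_head _ _)).
by rewrite mulrC ReMl ?ger0_real // mulr_ge0.
Qed.

(** The recursion can be solved for [X_(j+2)], so two consecutive vanishing
vectors propagate up to [X_n v = v]. *)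
Lemma continuants_coprime bs z v :
  evalmx (continuants bs).1 z *m v = 0 ->
  evalmx (continuants bs).2 z *m v = 0 -> v = 0.
Proof.
elim: bs => [|b bs IH] /=; first by rewrite evalmx1 mul1mx.
move=> x'v xv; apply: IH => //; move: x'v.
by rewrite evalmxD evalmxZ evalmxM mulmxDl -scalemxAl -mulmxA xv mulmx0 scaler0
  add0r.
Qed.

Lemma det_continuants_neq0 bs z : (forall b, b \in bs -> posdefmx b) ->
  0 <= 'Re z ->
  \det (evalmx ((continuants bs).1 + (continuants bs).2) z) != 0.
Proof.
move=> pbs z_ge0; apply/negP => /det_colP [v nzv].
rewrite evalmxD mulmxDl => xyv; case/eqP: nzv.
have := continuants_accretive v pbs z_ge0.
set x := evalmx (continuants bs).1 z *m v in xyv *.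
set y := evalmx (continuants bs).2 z *m v in xyv *.
have yE : y = (-1) *: x.
  by rewrite scaleN1r; apply/eqP; rewrite -addr_eq0 addrC xyv.
rewrite Re_dotC yE dotZr mulN1r raddfN oppr_ge0 /=.
rewrite (Creal_ReP _ _) ?ger0_real ?dot_ge0 // => x_le0.
have x0 : x = 0 by apply: dot_eq0; apply/eqP; rewrite eq_le x_le0 dot_ge0.
by apply: (@continuants_coprime bs z) => //; rewrite -/y yE x0 scaler0.
Qed.

(** A cofactor [V] could bring in zeros of its own; comparing the degrees of the
determinants shows that [det V] is constant. *)
Lemma Hurwitz_continuants bs n f V :
    (forall b, b \in bs -> posdefmx b) -> size bs = n ->
    (forall i j, (size (f i j) <= n.+1)%N) ->
    \det (map_mx (fun p : {poly C} => p`_n) f) != 0 ->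
    f = ((continuants bs).1 + (continuants bs).2) *m V ->
  Hurwitz_polynomial f.
Proof.
move=> pbs sbs sf topf fE z; have szf := size_det_top sf topf.
set F := _ + _ in fE; have [sx sy] := size_continuants bs.
have szF : size (\det F) = (q * n).+1.
  rewrite -sbs; apply: size_det_top => [i j|].
    rewrite mxE; apply: leq_trans (size_polyD _ _) _; rewrite geq_max sx /=.
    exact: leqW.
  rewrite (_ : map_mx _ F =
    map_mx (fun p : {poly C} => p`_(size bs)) (continuants bs).1).
    exact: det_coef_continuants.
  by apply/matrixP => i j; rewrite !mxE coefD [X in _ + X]nth_default ?addr0.
have detE : \det f = \det F * \det V by rewrite fE det_mulmx.
have nzF : \det F != 0 by rewrite -size_poly_gt0 szF.
have nzV : \det V != 0.
  by apply: contra_eq_neq szf => V0; rewrite detE V0 mulr0 size_poly0.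
have szV : size (\det V) = 1%N.
  move: szf; rewrite detE size_mul // szF addSn /= -addn1 => /eqP.
  by rewrite eqn_add2l => /eqP.
move=> /eqP; rewrite det_evalmx detE hornerM mulf_eq0 => /orP[F0|V0]; last first.
  have /size_poly1P [a nza VE] := introT eqP szV.
  by case/eqP: nza; move/eqP: V0; rewrite VE hornerC.
rewrite ltNge; apply/negP => z_ge0.
have z_ge0C : 0 <= 'Re z by rewrite -complexRe ler0c.
by have := det_continuants_neq0 pbs z_ge0C; rewrite det_evalmx F0.
Qed.

End Stability.

(** * Invertibility along the chains *)

Section Chains.
Variables (R : realType) (q : nat).
Local Notation C := R[i].
Local Notation RatMx := 'M[ratfun C]_q.
Implicit Types (T : RatMx) (b : 'M[C]_q) (P Q V : 'M[{poly C}]_q).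

Lemma ratmxM P Q : ratmx (P *m Q) = ratmx P *m ratmx Q.
Proof. exact: map_mxM. Qed.

Lemma ratmxD P Q : ratmx (P + Q) = ratmx P + ratmx Q.
Proof. exact: map_mxD. Qed.

Lemma ratmxB P Q : ratmx (P - Q) = ratmx P - ratmx Q.
Proof. exact: map_mxB. Qed.

Lemma ratmxZ (p : {poly C}) P : ratmx (p *: P) = tofrac p *: ratmx P.
Proof. exact: map_mxZ. Qed.

Lemma ratmx1 : ratmx 1%:M = 1%:M :> RatMx.
Proof. exact: map_mx1. Qed.

Lemma ratmx_inj : injective (@ratmx R q).
Proof.
move=> P Q /matrixP PQ; apply/matrixP => i j; apply/eqP.
by have := PQ i j; rewrite !mxE => /eqP; rewrite tofrac_eq.
Qed.

Lemma ratmx_unit P : (ratmx P \in unitmx) = (\det P != 0).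
Proof. by rewrite unitmxE det_map_mx unitfE tofrac_eq0. Qed.

(** The value [T(1) = P(1) Q(1)^-1] has a positive definite form, expressed
through a fraction [T = P Q^-1] since a matrix of rational functions cannot be
evaluated directly.  Positivity of the pairing forces [P(1)] and [Q(1)] to be
invertible, so this single condition also says that the fraction makes sense
and that [T] is invertible. *)
Definition positive_at1 T : Prop :=
  exists P Q, T *m ratmx Q = ratmx P /\
    forall v : 'cV[C]_q, v != 0 ->
      0 < dot (evalmx Q 1 *m v) (evalmx P 1 *m v).

Lemma positive_at1_unit T : positive_at1 T -> T \in unitmx.
Proof.
case=> P [Q [TQ pos]]; have : ratmx P \in unitmx.
  rewrite ratmx_unit; apply/negP => /eqP detP.
  have /eqP/det_colP[v nzv Pv] : \det (evalmx P 1) = 0.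
    by rewrite det_evalmx detP horner0.
  by have := pos v nzv; rewrite Pv /dot mulmx0 mxE ltxx.
rewrite -TQ unitmx_mul => /andP[uT _]; exact: uT.
Qed.

(** Inverting swaps numerator and denominator, which conjugates a pairing that
is real anyway. *)
Lemma positive_at1_inv T : positive_at1 T -> positive_at1 (invmx T).
Proof.
move=> posT; have uT := positive_at1_unit posT.
case: posT => P [Q [TQ pos]]; exists Q, P; split; first by rewrite -TQ mulKmx.
by move=> v nzv; rewrite dotC conj_Creal ?gtr0_real ?pos.
Qed.

(** The scalar [p] stands for [1] or [z], the multipliers of [d_k] and [c_k] in
the chain; both take the value [1] at the evaluation point. *)
Lemma positive_at1_const (p : {poly C}) b : p.[1] = 1 -> posdefmx b ->
  positive_at1 (tofrac p *: constmx b).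
Proof.
move=> p1 pb; exists (p *: map_mx polyC b), 1%:M; split=> [|v nzv].
  by rewrite ratmx1 mulmx1 ratmxZ.
by rewrite evalmx1 mul1mx evalmxZ p1 scale1r evalmxC posdef_dot.
Qed.

Lemma positive_at1_add (p : {poly C}) b T : p.[1] = 1 -> posdefmx b ->
  positive_at1 T -> positive_at1 (tofrac p *: constmx b + T).
Proof.
move=> p1 pb [P [Q [TQ pos]]].
exists (p *: (map_mx polyC b *m Q) + P), Q; split=> [|v nzv].
  by rewrite mulmxDl TQ ratmxD ratmxZ ratmxM -scalemxAl.
rewrite evalmxD evalmxZ evalmxM p1 scale1r evalmxC mulmxDl -mulmxA dotDr.
by rewrite ltr_wpDl ?pos ?posdef_dot_ge0.
Qed.

Lemma positive_at1_constmx b : posdefmx b -> positive_at1 (constmx b).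
Proof.
move=> pb; have := @positive_at1_const 1 b; rewrite tofrac1 scale1r; apply=> //.
by rewrite hornerC.
Qed.

Lemma positive_at1_addmx b T : posdefmx b -> positive_at1 T ->
  positive_at1 (constmx b + T).
Proof.
move=> pb; have := @positive_at1_add 1 b T; rewrite tofrac1 scale1r; apply=> //.
by rewrite hornerC.
Qed.

Lemma positive_at1_denominator b b' T : posdefmx b ->
  positive_at1 (constmx b' + T) ->
  positive_at1 (zvar R *: constmx b + invmx (constmx b' + T)).
Proof.
by move=> pb pT; apply: positive_at1_add; rewrite ?hornerX //;
  apply: positive_at1_inv.
Qed.

Lemma positive_at1_Psi (c d : nat -> 'M[C]_q) r k :
    (forall j, (j <= k + r)%N -> posdefmx (c j)) ->
    (forall j, (j <= k + r)%N -> posdefmx (d j)) ->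
  positive_at1 (Psi c d r k).
Proof.
elim: r k => [|r IH] k pc pd; apply: positive_at1_inv.
  rewrite -[constmx (d k)]addr0; apply: positive_at1_denominator.
    by apply: pc; rewrite addn0.
  by rewrite addr0; apply/positive_at1_constmx/pd; rewrite addn0.
apply: positive_at1_denominator; first by apply: pc; rewrite leq_addr.
apply: positive_at1_addmx; first by apply: pd; rewrite leq_addr.
by apply: IH => j; rewrite addSnnS; [apply: pc | apply: pd].
Qed.

Lemma positive_at1_Phi (c d : nat -> 'M[C]_q) r k :
    (forall j, (j <= k + r)%N -> posdefmx (c j)) ->
    (forall j, (j < k + r)%N -> posdefmx (d j)) ->
  positive_at1 (Phi c d r k).
Proof.
elim: r k => [|r IH] k pc pd.
  have pck : posdefmx (c k) by apply: pc; rewrite addn0.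
  have pT := positive_at1_const (hornerX 1) pck.
  rewrite /= -[_ *: _](_ : invmx (zvar R *: constmx (c k)) = _).
    exact: positive_at1_inv.
  by rewrite invmxZ // positive_at1_unit.
apply: positive_at1_inv; apply: positive_at1_denominator.
  by apply: pc; rewrite leq_addr.
apply: positive_at1_addmx; first by apply: pd; rewrite addnS ltnS leq_addr.
by apply: IH => j; rewrite addSnnS; [apply: pc | apply: pd].
Qed.

(** * Descent along the chains *)

Local Notation sq P := (map_mx (fun p : {poly C} => p \Po 'X^2) P).

(** One step of the Euclidean algorithm: undoing the outer inversion gives
[Q = (z b + (b' + T)^-1) P], so the remainder [Q'] is [(b' + T)^-1 P];
undoing the inner one gives [P = (b' + T) Q']. *)
Lemma chain_step_descent b b' T P Q : posdefmx b ->
    positive_at1 (constmx b' + T) ->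
    ratmx P = chain_step b b' T *m ratmx Q ->
  let Q' := Q - 'X *: (map_mx polyC b *m P) in
  ratmx (P - map_mx polyC b' *m Q') = T *m ratmx Q'.
Proof.
move=> pb pT PE Q'.
have Q'E : ratmx Q' = invmx (constmx b' + T) *m ratmx P.
  have := positive_at1_unit (positive_at1_denominator pb pT).
  move=> u.
  move/(congr1 (mulmx (zvar R *: constmx b + invmx (constmx b' + T)))): PE.
  rewrite mulKVmx // => /esym QE.
  by rewrite ratmxB QE ratmxZ ratmxM mulmxDl -scalemxAl addrC addKr.
rewrite ratmxB ratmxM -[ratmx P](mulKVmx (positive_at1_unit pT)) -Q'E.
by rewrite mulmxDl addrC addKr.
Qed.

(** In terms of the variable [w] of the chain, with [w = z^2], the pair
[(Q(z^2), z P(z^2))] is the one whose Euclidean remainders have quotients [z b_j]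
for the [c_k] and the [d_k] alike: the factor [z] on [P] splits the weights [w]
and [1] of the two kinds of steps evenly. *)
Definition expansion (n : nat) V Q P : Prop :=
  exists bs, [/\ forall b, b \in bs -> posdefmx b, size bs = n,
    sq Q = (continuants bs).1 *m V & 'X *: sq P = (continuants bs).2 *m V].

Lemma sqD P Q : sq (P + Q) = sq P + sq Q.
Proof. by apply/matrixP => i j; rewrite !mxE comp_polyD. Qed.

Lemma sqM P Q : sq (P *m Q) = sq P *m sq Q.
Proof. exact: (map_mxM (comp_poly 'X^2)). Qed.

Lemma sqC b : sq (map_mx polyC b) = map_mx polyC b.
Proof. by apply/matrixP => i j; rewrite !mxE comp_polyC. Qed.

Lemma sqXZ P : sq ('X *: P) = 'X^2 *: sq P.
Proof. by apply/matrixP => i j; rewrite !mxE comp_polyM comp_polyX. Qed.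

Lemma expansion_step n V b b' P Q : posdefmx b -> posdefmx b' ->
  let Q' := Q - 'X *: (map_mx polyC b *m P) in
  expansion n V Q' (P - map_mx polyC b' *m Q') -> expansion n.+2 V Q P.
Proof.
move=> pb pb' Q'; set P' := P - _ => -[bs [pbs sbs Q'E P'E]].
have QE : Q = 'X *: (map_mx polyC b *m P) + Q' by rewrite addrC subrK.
have PE : P = map_mx polyC b' *m Q' + P' by rewrite addrC subrK.
have XPE : 'X *: sq P = (continuants (b' :: bs)).1 *m V.
  by rewrite {1}PE sqD sqM sqC scalerDr Q'E P'E /= mulmxDl -scalemxAl mulmxA.
exists [:: b, b' & bs]; split.
- by move=> x; rewrite !inE => /or3P[/eqP->|/eqP->|/pbs].
- by rewrite -sbs.
- rewrite {1}QE sqD sqXZ sqM sqC Q'E continuants_cons mulmxDl; congr (_ + _).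
  by rewrite -scalemxAl -[in RHS]mulmxA -XPE -scalemxAr scalerA -expr2.
- exact: XPE.
Qed.

(** The descent ends with [P' = 0], and the last nonzero remainder [Q'], taken
at [z^2], is the common right factor. *)
Lemma expansion_Psi (c d : nat -> 'M[C]_q) r k P Q :
    (forall j, (j <= k + r)%N -> posdefmx (c j)) ->
    (forall j, (j <= k + r)%N -> posdefmx (d j)) ->
    ratmx P = Psi c d r k *m ratmx Q ->
  exists V, expansion r.+1.*2 V Q P.
Proof.
elim: r k P Q => [|r IH] k P Q pc pd PE.
  have pck : posdefmx (c k) by apply: pc; rewrite addn0.
  have pdk : posdefmx (d k) by apply: pd; rewrite addn0.
  (* The innermost fraction is a chain step with the zero matrix as its tail. *)
  exists (sq (Q - 'X *: (map_mx polyC (c k) *m P))).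
  apply: (expansion_step pck pdk).
  have pT : positive_at1 (constmx (d k) + 0).
    by rewrite addr0; apply: positive_at1_constmx.
  have := @chain_step_descent (c k) (d k) 0 P Q pck pT.
  rewrite /chain_step addr0 => /(_ PE) /=.
  rewrite mul0mx; set P' := P - _; set Q' := Q - _ => P'0.
  exists [::]; split=> //=; first by rewrite mul1mx.
  have -> : P' = 0 by apply: ratmx_inj; rewrite P'0 /ratmx map_mx0.
  by apply/matrixP => i j; rewrite mul0mx !mxE comp_poly0 mulr0.
have pck : posdefmx (c k) by apply: pc; rewrite leq_addr.
have pdk : posdefmx (d k) by apply: pd; rewrite leq_addr.
have pc' j : (j <= k.+1 + r)%N -> posdefmx (c j) by rewrite addSnnS; apply: pc.
have pd' j : (j <= k.+1 + r)%N -> posdefmx (d j) by rewrite addSnnS; apply: pd.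
have pT : positive_at1 (constmx (d k) + Psi c d r k.+1).
  by apply: positive_at1_addmx => //; apply: positive_at1_Psi.
have [V expV] := IH _ _ _ pc' pd' (chain_step_descent pck pT PE).
exists V; exact: expansion_step pck pdk expV.
Qed.

(** Here the last quotient leaves the last [P] as the greatest common divisor, and
it is paired with an extra factor [z]; that factor is recorded because it has
to be cancelled against the one in [z g(z)]. *)
Lemma expansion_Phi (c d : nat -> 'M[C]_q) r k P Q :
    (forall j, (j <= k + r)%N -> posdefmx (c j)) ->
    (forall j, (j < k + r)%N -> posdefmx (d j)) ->
    ratmx P = Phi c d r k *m ratmx Q ->
  exists V, expansion r.*2.+1 ('X *: V) Q P.
Proof.
elim: r k P Q => [|r IH] k P Q pc pd PE.
  have pck : posdefmx (c k) by apply: pc; rewrite addn0.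
  have uc := positive_at1_unit (positive_at1_constmx pck).
  have nz : zvar R != 0 by rewrite tofrac_eq0 polyX_eq0.
  have QE : Q = 'X *: (map_mx polyC (c k) *m P).
    apply: ratmx_inj; rewrite ratmxZ ratmxM PE /= -scalemxAl -scalemxAr scalerA.
    by rewrite (divff nz) scale1r (mulKVmx uc).
  exists (sq P), [:: c k]; split.
  - by move=> x; rewrite inE => /eqP->.
  - by [].
  - rewrite continuants_cons addr0 mulmx1 {1}QE sqXZ sqM sqC -scalemxAl.
    rewrite -scalemxAr scalerA.
    by rewrite expr2.
  - by rewrite mul1mx.
have pck : posdefmx (c k) by apply: pc; rewrite leq_addr.
have pdk : posdefmx (d k) by apply: pd; rewrite addnS ltnS leq_addr.
have pc' j : (j <= k.+1 + r)%N -> posdefmx (c j) by rewrite addSnnS; apply: pc.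
have pd' j : (j < k.+1 + r)%N -> posdefmx (d j) by rewrite addSnnS; apply: pd.
have pT : positive_at1 (constmx (d k) + Phi c d r k.+1).
  by apply: positive_at1_addmx => //; apply: positive_at1_Phi.
have [V expV] := IH _ _ _ pc' pd' (chain_step_descent pck pT PE).
exists V; exact: expansion_step pck pdk expV.
Qed.

End Chains.

(** * Hurwitz-type matrix polynomials *)

Section Parts.
Variables (C : comNzRingType) (q : nat).
Implicit Types f : 'M[{poly C}]_q.

Lemma coef_matpoly n (A : 'I_n.+1 -> 'M[C]_q) i j :
  (size (matpoly A i j) <= n.+1)%N /\ (matpoly A i j)`_n = A ord0 i j.
Proof.
rewrite /matpoly summxE; split.
  apply: leq_trans (size_sum _ _ _) _; apply/bigmax_leqP => k _.
  rewrite !mxE mulrC mul_polyC; apply: leq_trans (size_scale_leq _ _) _.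
  by rewrite size_polyXn ltnS leq_subr.
rewrite coef_sum (bigD1 ord0) //= !mxE mulrC coefCM subn0 coefXn eqxx mulr1.
rewrite big1 ?addr0 // => k nk0; rewrite !mxE mulrC coefCM coefXn.
have k_gt0 : (0 < k)%N by rewrite lt0n.
by rewrite gtn_eqF ?mulr0 // ltn_subrL k_gt0 (leq_trans k_gt0 (ltn_ord k)).
Qed.

End Parts.

Lemma det_neq0_of_top (C : fieldType) (q m : nat) (M : 'M[{poly C}]_q)
    (B : 'M[C]_q) :
  (forall i j, (M i j)`_m = B i j) ->
  (forall i j, (size (M i j) <= m.+1)%N) -> \det B != 0 -> \det M != 0.
Proof.
move=> topM sM detB; rewrite -size_poly_gt0 (size_det_top sM) //.
by rewrite (_ : map_mx _ M = B) //; apply/matrixP => i j; rewrite mxE topM.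
Qed.

Unset Implicit Arguments.

Theorem theorem4p3 (R : realType) (q n : nat) (A : 'I_n.+1 -> 'M[R[i]]_q)
    (q_gt0 : (0 < q)%N) (n_gt0 : (0 < n)%N) (detA0 : \det (A ord0) != 0) :
  HTM_polynomial n (matpoly A) -> Hurwitz_polynomial (matpoly A).
Proof.
set f := matpoly A.
have sf i j : (size (f i j) <= n.+1)%N := (coef_matpoly A i j).1.
have cf i j : (f i j)`_n = A ord0 i j := (coef_matpoly A i j).2.
have topf : \det (map_mx (fun p : {poly R[i]} => p`_n) f) != 0.
  by rewrite (_ : map_mx _ f = A ord0) //; apply/matrixP => i j; rewrite mxE cf.
have nE := odd_double_half n.
rewrite /HTM_polynomial; case: ifP nE => [_|_]; set m := n./2 => nE.
- case=> c [d [pc pd chain]].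
  have detg : \det (gpart f) != 0.
    apply: (@det_neq0_of_top _ _ m _ (A ord0)) detA0 => i j; rewrite mxE.
      by rewrite coef_odd_poly -cf -nE.
    apply: leq_trans (size_odd_poly _) _.
    by rewrite (leq_trans (half_leq (sf i j))) // -nE /= doubleK.
  have detXg : \det ('X *: gpart f) != 0.
    by rewrite detZ mulf_neq0 // expf_neq0 // polyX_eq0.
  have PE : ratmx (hpart f) = Phi c d m 0 *m ratmx ('X *: gpart f).
    by rewrite -chain -ratmxZ mulmxKV // ratmx_unit.
  have [V [bs [pbs sbs XgE XhE]]] := @expansion_Phi R q c d m 0 _ _ pc pd PE.
  apply: (Hurwitz_continuants (V := V) pbs _ sf topf); first by rewrite sbs -nE.
  have nzX : 'X != 0 :> {poly R[i]} by rewrite polyX_eq0.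
  (* The chain for z g(z) yields z f(z) = (X_0 + X_1) z V. *)
  have scaleXI : injective (fun M : 'M[{poly R[i]}]_q => 'X *: M).
    move=> M N /matrixP MN; apply/matrixP => i j; apply: (mulfI nzX).
    by have := MN i j; rewrite !mxE.
  apply: scaleXI; rewrite scalemxAr mulmxDl -XgE -XhE sqXZ addrC.
  by rewrite expr2 -scalerA -scalerDr [in LHS](parts_decomposition f) addrC.
- case=> m_gt0 [c [d [pc pd chain]]].
  have deth : \det (hpart f) != 0.
    apply: (@det_neq0_of_top _ _ m _ (A ord0)) detA0 => i j; rewrite mxE.
      by rewrite coef_even_poly -cf -nE.
    apply: leq_trans (size_even_poly _) _.
    by rewrite (leq_trans (uphalf_leq (sf i j))) // -nE /= uphalf_double.
  have PE : ratmx (gpart f) = Psi c d m.-1 0 *m ratmx (hpart f).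
    by rewrite -chain mulmxKV // ratmx_unit.
  have pc' j : (j <= 0 + m.-1)%N -> posdefmx (c j).
    by rewrite add0n -ltnS prednK //; apply: pc.
  have pd' j : (j <= 0 + m.-1)%N -> posdefmx (d j).
    by rewrite add0n -ltnS prednK //; apply: pd.
  have [V [bs [pbs sbs hE gE]]] := expansion_Psi pc' pd' PE.
  apply: (Hurwitz_continuants (V := V) pbs _ sf topf).
    by rewrite sbs prednK // -nE.
  by rewrite mulmxDl -hE -gE; apply: parts_decomposition.
Qed.
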